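(* Let $G=(V,E)$ be a finite simple graph, let $U\subseteq V$ be such that $G$ is $U$-threshold, and let $v_1,\dots,v_n$ be an ordering of $V$ such that for every $i$, $N^<(v_i)=\emptyset$ or $N^<(v_i)=U\cap\{v_1,\dots,v_{i-1}\}$. Let $D=\{v_i\in V: N^<(v_i)\neq\emptyset\}$ and $D_U=D\cap U$. Then the number $\tau(G)$ of spanning trees of $G$ satisfies $$\tau(G)=\frac{\prod_{v_i\in D_U}\left(\deg(v_i)+1\right)\cdot\prod_{v_j\in V\setminus D_U}\deg(v_j)}{|D|\cdot|U|}.$$
   Context: Graphs are finite, without loops or parallel edges. $N(v)$ is the set of neighbors of $v$, $\deg(v)=|N(v)|$, and for $W\subseteq V$, $N_W(v)=N(v)\cap W$ and $G[W]$ is the induced subgraph on $W$. For an ordering $v_1,\dots,v_n$ of $V$, $N^<(v_i)=N(v_i)\cap\{v_1,\dots,v_{i-1}\}$. For $U\subseteq V$, $G$ is $U$-threshold if for every nonempty $W\subseteq V$ the induced subgraph $G[W]$ contains a vertex $v$ with $N_W(v)=\emptyset$ or $N_W(v)=(W\setminus\{v\})\cap U$. Vertices in $D$ are called $U$-dominating. A spanning tree of $G$ is a connected acyclic subgraph containing all vertices of $G$. *)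

(* Defs.v *)
From mathcomp Require Import all_boot.

Set Implicit Arguments.
Unset Strict Implicit.
Unset Printing Implicit Defensive.

Section Graph.

Variables (V : finType) (e : rel V).

Definition nbr (x : V) : {set V} := [set y | e x y].

Definition deg (x : V) : nat := #|nbr x|.

Definition threshold (U : {set V}) : Prop :=
  forall W : {set V}, W != set0 ->
    exists2 x, x \in W &
      nbr x :&: W = set0 \/ nbr x :&: W = (W :\ x) :&: U.

(* The vertices v_1, ..., v_n are written v 0, ..., v (n - 1). *)
Definition before n (v : 'I_n -> V) (i : 'I_n) : {set V} :=
  [set v j | j : 'I_n & j < i].

Definition nbr_lt n (v : 'I_n -> V) (i : 'I_n) : {set V} :=
  nbr (v i) :&: before v i.

Definition dominating n (v : 'I_n -> V) : {set V} :=
  [set v i | i : 'I_n & nbr_lt v i != set0].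

Definition edges : {set {set V}} :=
  [set [set p.1; p.2] | p : V * V & e p.1 p.2].

(* A subgraph containing all vertices is determined by its set F of edges. *)
Definition edge_rel (F : {set {set V}}) : rel V :=
  [rel x y | (x != y) && ([set x; y] \in F)].

Definition connected (r : rel V) : bool := [forall x, forall y, connect r x y].

(* Cycles have length at least 3. A cycle has no repeated vertex, so bounding
   its length by #|V| makes the property boolean without changing its meaning;
   see acyclicP. *)
Definition acyclic (r : rel V) : bool :=
  [forall k : 'I_#|V|.+1, forall c : k.-tuple V, (2 < k) ==> ~~ ucycleb r c].

Lemma acyclicP (r : rel V) :
  reflect (forall c : seq V, 2 < size c -> ~ ucycle r c) (acyclic r).
Proof.
apply: (iffP idP) => [/forallP acr c c_gt2 cyc | acr].
  have c_le : size c < #|V|.+1.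
    by case/andP: cyc => _ /card_uniqP <-; rewrite ltnS max_card.
  have /forallP/(_ (in_tuple c)) := acr (Ordinal c_le).
  by rewrite /= c_gt2 /= => /negP; apply.
apply/forallP => k; apply/forallP => c; apply/implyP => k_gt2.
by apply/negP; apply: acr; rewrite size_tuple.
Qed.

Definition spanning_trees : {set {set {set V}}} :=
  [set F : {set {set V}} |
    [&& F \subset edges, connected (edge_rel F) & acyclic (edge_rel F)]].

Definition tau : nat := #|spanning_trees|.

End Graph.

(* Main.v *)
(** Write D and U also for their indicator vectors, and let L be the Laplacian
    of G. With the vertices ordered as v_1, ..., v_n, the matrix L + D U^T is
    upper triangular: below the diagonal an entry of L is -1 exactly when its
    row is in D and its column is in U. Its diagonal entries are deg(x) + 1 for
    x in D and U, and deg(x) otherwise. On the other hand, all cofactors of L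
    equal tau(G), so that det(L + a b^T) = (sum a) (sum b) tau(G) for all
    vectors a and b.

    For the matrix-tree theorem itself, a principal cofactor of L is expanded
    by multilinearity of its rows L_x = sum over y ~ x of (1_x - 1_y) into a sum
    over functions choosing a neighbor of every vertex but the root; the
    functions whose iterates all reach the root contribute 1 and correspond to
    spanning trees, the others contribute 0. *)

Require Import Defs.
From mathcomp Require Import all_boot all_order all_algebra fingroup perm.
Import GRing.Theory Num.Theory.
Local Open Scope ring_scope.

(** * Depth below a root *)

Lemma connect_depth (V : finType) (T : rel V) (r : V) :
  (forall x, connect T x r) ->
  exists d : V -> nat, forall x, x != r -> exists2 y, T x y & (d y < d x)%N.
Proof.
move=> conT.
have ex_path x : exists k, [exists p : k.-tuple V, path T x p && (last x p == r)].
  have /connectP[p Tp lastp] := conT x.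
  exists (size p); apply/existsP; exists (in_tuple p).
  by rewrite Tp /= -lastp.
(* The depth of [x] is the length of a shortest path to [r]; the next vertex on such a path is
   strictly closer. *)
exists (fun x => ex_minn (ex_path x)) => x xr.
case: ex_minnP => k /existsP[p /andP[Tp /eqP lastp]] _.
case: p Tp lastp => -[|y p] /= /eqP sz_p; first by move=> _ /eqP; rewrite (negPf xr).
move=> /andP[Txy Tp] lastp; exists y => //.
case: ex_minnP => m _ /(_ (size p)); rewrite -sz_p ltnS; apply.
by apply/existsP; exists (in_tuple p); rewrite Tp lastp /=.
Qed.

Lemma fconnect_depth {V : finType} {F : V -> V} {r : V} :
  (forall x, fconnect F x r) ->
  exists d : V -> nat, forall x, x != r -> (d (F x) < d x)%N.
Proof.
move=> /connect_depth[d dF]; exists d => x /dF[y].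
by rewrite /= => /eqP->.
Qed.

Lemma depth_fconnect (V : finType) (F : V -> V) (r : V) (d : V -> nat) :
  (forall x, x != r -> (d (F x) < d x)%N) -> forall x, fconnect F x r.
Proof.
move=> dF x; have [k] := ubnP (d x); elim: k x => // k IHk x dx.
have [->|xr] := eqVneq x r; first exact: connect0.
apply: connect_trans (fconnect1 F x) (IHk _ _).
by apply: leq_trans (dF _ xr) _.
Qed.

(** * Spanning trees as parent functions *)

Section ParentFunctions.

Variables (V : finType) (e : rel V) (r : V).

(** Fixing [F r = r] leaves exactly one parent function for each tree, so that counting functions
    counts trees. *)
Definition rooted (F : V -> V) : bool :=
  [&& F r == r, [forall (x | x != r), e x (F x)] & [forall x, fconnect F x r]].

Definition parent_edges (F : V -> V) : {set {set V}} :=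
  [set [set x; F x] | x : V & x != r].

Lemma set2_eqE (a b x y : V) :
  ([set a; b] == [set x; y]) = ((a == x) && (b == y)) || ((a == y) && (b == x)).
Proof.
apply/eqP/idP => [E|/orP[]/andP[/eqP-> /eqP->] //]; last exact: setUC.
have := set21 a b; have := set22 a b; have := set21 x y; have := set22 x y.
rewrite E -[in x \in _]E -[in y \in _]E !inE.
rewrite [x == a]eq_sym [x == b]eq_sym [y == a]eq_sym [y == b]eq_sym.
by do 4!case: eqP => //=.
Qed.

Lemma parent_edgesP F x y :
  reflect ((x != r /\ F x = y) \/ (y != r /\ F y = x))
          ([set x; y] \in parent_edges F).
Proof.
apply: (iffP imsetP) => [[z]|[[xr <-]|[yr <-]]].
- rewrite inE => zr /eqP; rewrite set2_eqE.
  by case/orP => /andP[/eqP-> /eqP->]; [left | right].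
- by exists x; rewrite ?inE.
- by exists y; rewrite ?inE // setUC.
Qed.

Lemma rooted_tree F : symmetric e -> irreflexive e ->
  rooted F -> parent_edges F \in spanning_trees e.
Proof.
move=> e_sym e_irr /and3P[/eqP Fr /forall_inP eF /forallP conF].
rewrite inE; apply/and3P; split.
- apply/subsetP => A /imsetP[x]; rewrite inE => xr -> {A}.
  by apply/imsetP; exists (x, F x); rewrite // inE; apply: eF.
- have rel_sym : connect_sym (edge_rel (parent_edges F)).
    apply: sym_connect_sym => x y; rewrite /edge_rel /= eq_sym.
    by rewrite [[set x; y]]setUC.
  have con_r x : connect (edge_rel (parent_edges F)) x r.
    have [d dF] := fconnect_depth conF.
    have [k] := ubnP (d x); elim: k x => // k IHk x dx.
    have [->|xr] := eqVneq x r; first exact: connect0.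
    apply: connect_trans (connect1 _) (IHk (F x) (leq_trans (dF _ xr) dx)).
    rewrite /edge_rel /=; apply/andP; split; last first.
      by apply/parent_edgesP; left.
    by apply: contraTneq (eF x xr) => <-; rewrite e_irr.
  apply/forallP => x; apply/forallP => y.
  by apply: connect_trans (con_r x) _; rewrite rel_sym.
apply/acyclicP => c c_gt2 /andP[cyc uc].
have [d dF] := fconnect_depth conF.
have [x0 x0c] : exists x, x \in c.
  by case: (c) c_gt2 => // x s _; exists x; rewrite mem_head.
pose x := [arg max_(x > x0 in c) d x]%N.
have [xc x_max] : x \in c /\ forall y, y \in c -> (d y <= d x)%N.
  by rewrite /x; case: arg_maxnP.
(* A vertex of a cycle lying deepest in the tree would have its parent as both
   of its neighbours on the cycle. *)
have FxE y : y \in c ->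
    edge_rel (parent_edges F) x y || edge_rel (parent_edges F) y x -> y = F x.
  move=> yc H; have {H} : [set x; y] \in parent_edges F.
    by case/orP: H => /andP[_ //]; rewrite setUC.
  case/parent_edgesP => [[_ <-] //|[yr Fy]].
  by have := dF _ yr; rewrite Fy ltnNge x_max.
have [i s rotc] := rot_to xc.
have := c_gt2; have := uc; have := cyc.
rewrite -(rot_cycle i) -(rot_uniq i) -(size_rot i) rotc.
case: s rotc => [|y s] //; case/lastP: s => [|s z] // rotc cyc' uc' _.
move: cyc' uc'; rewrite (cycle_path x) /= last_rcons rcons_path /=.
case/and3P=> ezx exy _ /and3P[_ yNs _].
have zc : z \in c by rewrite -(mem_rot i) rotc !inE mem_rcons mem_head !orbT.
have yc : y \in c by rewrite -(mem_rot i) rotc !inE eqxx !orbT.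
have yE : y = F x by apply: FxE => //; rewrite exy.
have zE : z = F x by apply: FxE => //; rewrite ezx orbT.
by rewrite yE -zE mem_rcons mem_head in yNs.
Qed.

Lemma parent_edges_inj F G :
  rooted F -> rooted G -> parent_edges F = parent_edges G -> F =1 G.
Proof.
move=> /and3P[/eqP Fr _ /forallP conF] /and3P[/eqP Gr _ _] FG x.
have [d dF] := fconnect_depth conF.
apply/eqP; have [k] := ubnP (d x); elim: k x => // k IHk x dx.
have [->|xr] := eqVneq x r; first by rewrite Fr Gr.
have dFx := dF _ xr.
have /parent_edgesP[[_ ->] //|[Fxr GFx]] : [set x; F x] \in parent_edges G.
  by rewrite -FG; apply/parent_edgesP; left.
(* Otherwise x would be the parent of F x under G, hence also under F. *)
have FFx : F (F x) = x by rewrite -[RHS]GFx; apply/eqP/IHk/(leq_trans dFx).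
by have := ltn_trans (dF _ Fxr) dFx; rewrite FFx ltnn.
Qed.

(** Sending each vertex to a [T]-neighbour nearer to [r] gives a spanning tree inside [T]; since [T]
    is acyclic, it has no further edge. *)
Lemma tree_rooted T : symmetric e -> irreflexive e ->
  T \in spanning_trees e -> exists2 F : {ffun V -> V}, rooted F & parent_edges F = T.
Proof.
move=> e_sym e_irr; rewrite inE => /and3P[/subsetP Te conT /acyclicP acT].
have edge_e x y : edge_rel T x y -> e x y.
  case/andP => _ /Te/imsetP[[a b]]; rewrite inE /= => eab /eqP.
  by rewrite set2_eqE => /orP[]/andP[/eqP-> /eqP->] //; rewrite e_sym.
have [d dT] : exists d : V -> nat,
    forall x, x != r -> exists2 y, edge_rel T x y & (d y < d x)%N.
  by apply: connect_depth => x; move/forallP/(_ x)/forallP: conT.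
pose F := [ffun x => if x == r then r
                     else odflt x [pick y | edge_rel T x y && (d y < d x)%N]].
have FP x : x != r -> edge_rel T x (F x) && (d (F x) < d x)%N.
  move=> xr; rewrite ffunE (negPf xr); case: pickP => //= noy.
  by have [y Txy dyx] := dT _ xr; have := noy y; rewrite Txy dyx.
have Fr : F r = r by rewrite ffunE eqxx.
have rootF : rooted F.
  rewrite /rooted Fr eqxx /=; apply/andP; split.
    by apply/forall_inP => x /FP/andP[/edge_e].
  by apply/forallP; apply: (@depth_fconnect _ _ _ d) => x /FP/andP[].
have FT : parent_edges F \subset T.
  apply/subsetP => A /imsetP[x]; rewrite inE => /FP/andP[/andP[_ TF] _] -> //.
exists F => //; apply/eqP; rewrite eqEsubset FT /=.
apply/subsetP => A TA; have /imsetP[[x y]] := Te _ TA.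
rewrite inE /= => exy EA; rewrite {A}EA in TA *.
apply: contraT => Fxy.
have sub_FT : subrel (edge_rel (parent_edges F)) (edge_rel T).
  by move=> a b /andP[ab Fab]; rewrite /edge_rel /= ab (subsetP FT).
have xNy : x != y by apply: contraTneq exy => ->; rewrite e_irr.
have /connectP[p0 Fp0 Ep0] : connect (edge_rel (parent_edges F)) y x.
  have := rooted_tree _ e_sym e_irr rootF; rewrite inE => /and3P[_ conF _].
  by move/forallP/(_ y)/forallP: conF.
(* An edge of T missing from the tree of F closes a cycle. *)
case/shortenP: Fp0 Ep0 => p Fp up _ Ep.
case: (acT (y :: p)).
  (* The cycle has length at least 3: an empty [p] would give [x = y], and a single step would make
     the missing edge a parent edge. *)
  case: p Fp Ep {up} => [|z [|z' p]] //=;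
    first by move=> _ xy; rewrite xy eqxx in xNy.
  by rewrite andbT => /andP[_ Fyz] xz; rewrite xz setUC Fyz in Fxy.
rewrite /ucycle up andbT /= rcons_path (sub_path sub_FT Fp) -Ep.
by rewrite /edge_rel /= xNy TA.
Qed.

Lemma tau_rooted : symmetric e -> irreflexive e ->
  tau e = #|[set F : {ffun V -> V} | rooted F]|.
Proof.
move=> e_sym e_irr.
rewrite -(@card_in_imset _ _ (fun F : {ffun V -> V} => parent_edges F)); last first.
  by move=> F G; rewrite !inE => rF rG /(parent_edges_inj _ _ rF rG)/ffunP.
congr #|pred_of_set _|; apply/setP => T; apply/idP/imsetP.
  by move=> /(tree_rooted _ e_sym e_irr)[F rF <-]; exists F; rewrite ?inE.
by case=> F; rewrite inE => rF ->; apply: rooted_tree.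
Qed.

End ParentFunctions.

(** * Determinants and cofactors *)

Section Determinants.

Variables (R : comNzRingType) (n : nat).
Implicit Types (A : 'M[R]_n) (r i j : 'I_n).

(** In the Leibniz formula, each product of sums expands over the choice functions [f]. *)
Lemma det_sum_rows (K : finType) (B : 'I_n -> K -> 'I_n -> R) :
  \det (\matrix_(i, j) \sum_k B i k j) =
  \sum_(f : {ffun 'I_n -> K}) \det (\matrix_(i, j) B i (f i) j).
Proof.
rewrite /determinant exchange_big /=; apply: eq_bigr => s _.
rewrite -big_distrr /=; congr (_ * _).
under eq_bigr => i _ do rewrite mxE.
rewrite bigA_distr_bigA; apply: eq_bigr => f _.
by apply: eq_bigr => i _; rewrite mxE.
Qed.

Lemma cofactor_eq (A B : 'M[R]_n) i j :
  (forall k l, k != i -> l != j -> A k l = B k l) ->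
  cofactor A i j = cofactor B i j.
Proof.
move=> AB; congr (_ * \det _); apply/matrixP => k l; rewrite !mxE.
by apply: AB; rewrite eq_sym neq_lift.
Qed.

(** Multiplying the hypothesis by [\adj A] leaves [\det A] in every entry on the left and [c] times
    column [r] of [\adj A] on the right. *)
Lemma det_row_sums A r (c : R) :
  A *m const_mx 1 = c *: delta_mx r (0 : 'I_1) -> \det A = c * cofactor A r r.
Proof.
move=> A1; have := congr1 (mulmx (\adj A)) A1.
rewrite mulmxA mul_adj_mx mul_scalar_mx -scalemxAr => /matrixP/(_ r 0).
rewrite !mxE mulr1 => ->; congr (_ * _).
rewrite (bigD1 r) //= !mxE !eqxx mulr1 big1 ?addr0 // => j jr.
by rewrite !mxE (negPf jr) mulr0.
Qed.

Lemma det_delta_row A r : (forall j, A r j = (r == j)%:R) ->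
  \det A = cofactor A r r.
Proof.
move=> Ar; rewrite (expand_det_row _ r) (bigD1 r) //= Ar eqxx mul1r big1 ?addr0 //.
by move=> j jr; rewrite Ar eq_sym (negPf jr) mul0r.
Qed.

Lemma det_add_rank1 A r (a b : 'I_n -> R) :
  (forall i, \sum_j A i j = 0) -> (forall j, \sum_i A i j = 0) ->
  \det (\matrix_(i, j) (A i j + a i * b j)) =
  (\sum_i a i) * (\sum_j b j) * cofactor A r r.
Proof.
move=> rows cols.
(* A + a b^T = P Q, where P is the identity with column r replaced by a and the
   rest of row r by -1, and Q is A with row r replaced by b. *)
pose P := \matrix_(i, j) (if j == r then a i
                          else if i == r then -1 else (i == j)%:R : R).
pose Q := \matrix_(i, j) (if i == r then b j else A i j).
have -> : \matrix_(i, j) (A i j + a i * b j) = P *m Q.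
  apply/matrixP => i j; rewrite !mxE (bigD1 r) //= !mxE !eqxx addrC; congr (_ + _).
  have [->|ir] := eqVneq i r.
    have := cols j; rewrite (bigD1 r) //= => /eqP; rewrite addr_eq0 => /eqP ->.
    rewrite -sumrN; apply: eq_bigr => k kr.
    by rewrite !mxE (negPf kr) eqxx mulN1r.
  rewrite (bigD1 i) //= !mxE (negPf ir) eqxx mul1r big1 ?addr0 // => k /andP[kr ki].
  by rewrite !mxE (negPf kr) (negPf ir) eq_sym (negPf ki) mul0r.
rewrite det_mulmx -mulrA; congr (_ * _).
  (* Column [r] of [P] sums to [\sum_i a i] and every other column to 1 - 1 = 0; away from row and
     column [r], [P] is the identity. *)
  rewrite -det_tr (@det_row_sums _ r (\sum_i a i)).
    rewrite (@cofactor_eq _ 1%:M) => [|k l kr lr].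
      rewrite -det_delta_row ?det1 ?mulr1 // => j.
      by rewrite mxE.
    by rewrite !mxE (negPf kr) (negPf lr) eq_sym.
  apply/matrixP => i j; rewrite !mxE !ord1 andbT.
  under eq_bigr => k do rewrite !mxE mulr1.
  case: (eqVneq i r) => [ir|ir]; first by rewrite mulr1.
  rewrite mulr0 (bigD1 r) //= eqxx (bigD1 i) //= (negPf ir) eqxx.
  rewrite big1 ?addr0 ?addNr // => k /andP[kr ki].
  by rewrite (negPf kr) (negPf ki).
(* Only row [r] of [Q] can have a nonzero sum. *)
rewrite (@det_row_sums _ r (\sum_j b j)).
  congr (_ * _); apply: cofactor_eq => // k l kr _.
  by rewrite mxE (negPf kr).
apply/matrixP => i j; rewrite !mxE !ord1 andbT.
under eq_bigr => k do rewrite !mxE mulr1.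
by case: (eqVneq i r) => ir; rewrite ?mulr1 // mulr0.
Qed.

End Determinants.

(* The matrix of an acyclic parent function becomes triangular when indices are
   sorted by depth; otherwise the indicator of the vertices that never reach
   the root is in its kernel. *)
Lemma det_parent_function (R : fieldType) n (r : 'I_n) (f : 'I_n -> 'I_n) :
  f r = r ->
  \det (\matrix_(i, j) ((i == j)%:R - ((i != r) && (f i == j))%:R) : 'M[R]_n) =
  [forall i, fconnect f i r]%:R.
Proof.
move=> fr; set A := (\matrix_(i, j) _).
have [/forallP conf | /forallPn[i0 ni0]] := boolP [forall i, fconnect f i r]; last first.
  apply/eqP; rewrite -det_tr; apply/det0P.
  exists (\row_j (~~ fconnect f j r)%:R).
    apply: contraNneq ni0 => /matrixP/(_ 0 i0); rewrite !mxE.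
    by case: (fconnect f i0 r) => //= /eqP; rewrite oner_eq0.
  apply/matrixP => k i; rewrite !mxE.
  under eq_bigr => j _ do rewrite !mxE mulrBr.
  rewrite sumrB (bigD1 i) //= eqxx mulr1 big1 => [|j]; last first.
    by rewrite eq_sym => /negPf ->; rewrite mulr0.
  rewrite addr0; have [->|ir] := eqVneq i r.
    by rewrite connect0 big1 ?subr0 // => j; rewrite mulr0.
  rewrite (bigD1 (f i)) //= eqxx mulr1 big1 => [|j]; last first.
    by rewrite eq_sym => /negPf ->; rewrite mulr0.
  suff -> : fconnect f i r = fconnect f (f i) r by rewrite addr0 subrr.
  apply/idP/idP => [/iter_findex|]; last exact/connect_trans/fconnect1.
  case: (findex f i r) => [/eqP|m]; first by rewrite (negPf ir).
  by rewrite iterSr => <-; apply: fconnect_iter.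
have [d df] := fconnect_depth conf.
rewrite /determinant (bigD1 (1%g : 'S_n)) //= odd_perm1 expr0 mul1r.
rewrite [X in X + _]big1 => [|i _]; last first.
  rewrite mxE perm1 eqxx; have [//|ir] := eqVneq i r; first by rewrite subr0.
  by case: eqP (df _ ir) => [->|]; rewrite ?ltnn ?subr0.
rewrite big1 ?addr0 // => s s1.
apply/eqP; move: s1; apply: contraNT; rewrite mulf_eq0 signr_eq0 /= => /prodf_neq0 nz.
(* A permutation with nonzero product moves each index to itself or its parent, never deeper. The
   total depth is invariant under [s], so no index moves. *)
have d_leqif i : (d (s i) <= d i ?= iff (s i == i))%N.
  have [->|si] := eqVneq (s i) i; first exact/leqif_refl.
  have := nz i isT; rewrite mxE [i == _]eq_sym (negPf si) sub0r oppr_eq0.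
  have [/andP[ir /eqP <-] _|_] := boolP (_ && _); last by rewrite eqxx.
  by split; [exact/ltnW/df | rewrite ltn_eqF ?df].
have [_] := @leqif_sum _ predT _ _ _ (fun i _ => d_leqif i).
rewrite [X in _ == X](reindex_inj (@perm_inj _ s)) eqxx => /esym/forallP fix_s.
by apply/eqP/permP => i; rewrite perm1; apply/eqP/(fix_s i).
Qed.

(** * The matrix-tree theorem *)

Lemma fconnect_conj (S T : finType) (h : S -> T) (g : S -> S) (f : T -> T) :
  injective h -> (forall x, h (g x) = f (h x)) ->
  forall x y, fconnect g x y = fconnect f (h x) (h y).
Proof.
move=> h_inj hg x y.
have h_iter k : h (iter k g x) = iter k f (h x) by elim: k => //= k <-.
apply/idP/idP => /iter_findex; first by move=> <-; rewrite h_iter fconnect_iter.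
by rewrite -h_iter => /h_inj <-; apply: fconnect_iter.
Qed.

Lemma sum_mem (V : finType) (A : {set V}) : \sum_x (x \in A)%:R = #|A|%:R :> rat.
Proof.
rewrite -natr_sum -sum1_card [in RHS]big_mkcond; congr _%:R.
Qed.

Lemma sum_adj {V : finType} (e : rel V) x : \sum_y (e x y)%:R = (deg e x)%:R :> rat.
Proof. by rewrite -sum_mem; apply: eq_bigr => y _; rewrite inE. Qed.

Definition laplacian {V : finType} (e : rel V) {n} (v : 'I_n -> V) : 'M[rat]_n :=
  \matrix_(i, j) ((i == j)%:R * (deg e (v i))%:R - (e (v i) (v j))%:R).

Lemma matrix_tree (V : finType) (e : rel V) n (v : 'I_n -> V) (r : 'I_n) :
  symmetric e -> irreflexive e -> bijective v ->
  cofactor (laplacian e v) r r = (tau e)%:R.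
Proof.
move=> e_sym e_irr v_bij; have v_inj := bij_inj v_bij.
have [u vK uK] := v_bij.
rewrite (tau_rooted _ _ (v r)) //.
(* The root may only choose itself, which makes row [r] a unit vector and turns the cofactor into a
   full determinant. *)
pose w i k := if i == r then k == v r else e (v i) k.
pose b i k j : rat := (w i k)%:R * ((i == j)%:R - ((i != r) && (k == v j))%:R).
have sum_b i j :
    \sum_k b i k j = if i == r then (r == j)%:R else laplacian e v i j.
  rewrite /b /w; have [->|ir] := eqVneq i r.
    rewrite (bigD1 (v r)) //= eqxx mul1r subr0 big1 ?addr0 // => k kr.
    by rewrite (negPf kr) mul0r.
  rewrite mxE; under eq_bigr => k _ do rewrite mulrBr /=.
  rewrite sumrB -big_distrl /= sum_adj mulrC; congr (_ - _).
  rewrite (bigD1 (v j)) //= eqxx mulr1 big1 ?addr0 // => k kj.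
  by rewrite (negPf kj) mulr0.
rewrite (@cofactor_eq _ _ _ (\matrix_(i, j) \sum_k b i k j)) => [|k l kr _]; last first.
  by rewrite [RHS]mxE sum_b (negPf kr).
rewrite -det_delta_row => [|j]; last by rewrite mxE sum_b eqxx.
rewrite det_sum_rows -sum1_card natr_sum [in RHS]big_mkcond /=.
rewrite (reindex (fun F : {ffun V -> V} => [ffun i => F (v i)])) /=; last first.
  exists (fun f : {ffun 'I_n -> V} => [ffun x => f (u x)]) => F _;
    by apply/ffunP => x; rewrite !ffunE ?uK ?vK.
apply: eq_bigr => F _; rewrite inE.
pose f i := u (F (v i)).
(* A choice that is not allowed gives a zero row, and such an [F] is not [rooted]. *)
have [/forallP wF|/forallPn[i wF]] := boolP [forall i, w i (F (v i))]; last first.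
  rewrite (expand_det_row _ i) big1 => [|j _]; last first.
    by rewrite mxE /b ffunE (negPf wF) !mul0r.
  case: ifP => // /and3P[/eqP Fr /forall_inP eF _]; move: wF; rewrite /w.
  by case: eqVneq => [->|ir]; rewrite ?Fr ?eqxx // eF // (inj_eq v_inj).
have Fr : F (v r) = v r by have := wF r; rewrite /w eqxx => /eqP.
have -> : \matrix_(i, j) b i ([ffun i0 => F (v i0)] i) j =
    \matrix_(i, j) ((i == j)%:R - ((i != r) && (f i == j))%:R).
  apply/matrixP => i j; rewrite !mxE /b ffunE wF mul1r.
  by rewrite -(inj_eq v_inj (f i)) uK.
rewrite det_parent_function; last by rewrite /f Fr vK.
rewrite /rooted Fr eqxx /=.
have -> : [forall (x | x != v r), e x (F x)].
  apply/forall_inP => x; rewrite -[x]uK (inj_eq v_inj) => /negPf ur.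
  by have := wF (u x); rewrite /w ur.
have -> : [forall i, fconnect f i r] = [forall x, fconnect F x (v r)].
  have conj := @fconnect_conj _ _ v f F v_inj (fun i => uK _).
  apply/forallP/forallP => con x; last by rewrite conj.
  by rewrite -[x]uK -conj.
by case: [forall x, _].
Qed.

Lemma laplacian_row_sum (V : finType) (e : rel V) n (v : 'I_n -> V) i :
  bijective v -> \sum_j laplacian e v i j = 0.
Proof.
move=> v_bij; under eq_bigr => j _ do rewrite mxE.
rewrite sumrB (bigD1 i) //= eqxx mul1r big1 => [|j]; last first.
  by rewrite eq_sym => /negPf ->; rewrite mul0r.
rewrite addr0 -sum_adj (reindex v) ?subrr //; exact: onW_bij.
Qed.

Lemma laplacian_sym (V : finType) (e : rel V) n (v : 'I_n -> V) i j :
  symmetric e -> laplacian e v i j = laplacian e v j i.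
Proof.
move=> e_sym; rewrite !mxE e_sym eq_sym.
by case: eqVneq => [->|]; rewrite ?mul0r.
Qed.

(** * Spanning trees of threshold graphs *)

Theorem theorem3p4 (V : finType) (e : rel V)
    (e_sym : symmetric e) (e_irr : irreflexive e)
    (U : {set V}) (thrU : threshold e U)
    (n : nat) (v : 'I_n -> V) (v_bij : bijective v)
    (v_ord : forall i : 'I_n,
       nbr_lt e v i = set0 \/ nbr_lt e v i = U :&: before v i)
    (D_neq0 : dominating e v != set0) :
  let D := dominating e v in
  let DU := D :&: U in
  (tau e)%:R =
    ((\prod_(x in DU) (deg e x).+1%:R) * \prod_(x in ~: DU) (deg e x)%:R)
      / (#|D|%:R * #|U|%:R) :> rat.
Proof.
move=> D DU; have v_inj := bij_inj v_bij.
have vD i : (v i \in D) = (nbr_lt e v i != set0).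
  apply/imsetP/idP => [[j]|nb]; last by exists i; rewrite ?inE.
  by rewrite inE => nb /v_inj->.
have vbefore i j : (v j \in before v i) = (j < i)%N.
  apply/imsetP/idP => [[k]|ji]; last by exists j; rewrite ?inE.
  by rewrite inE => ki /v_inj->.
(* Adjacency to an earlier vertex is a product of indicators, which is what the rank-one term
   cancels. *)
have eD (i j : 'I_n) : (j < i)%N -> e (v i) (v j) = (v i \in D) && (v j \in U).
  move=> ji; have : (v j \in nbr_lt e v i) = e (v i) (v j).
    by rewrite !inE vbefore ji andbT.
  rewrite vD; case: (v_ord i) => nbE; first by rewrite nbE eqxx inE => <-.
  have [->|nb] := eqVneq (nbr_lt e v i) set0; first by rewrite inE => <-.
  by rewrite nbE inE vbefore ji andbT => <-.
have [r rD] : exists r, v r \in D.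
  have /set0Pn[x xD] := D_neq0; have [u _ uK] := v_bij.
  by exists (u x); rewrite uK.
have U_neq0 : U != set0.
  rewrite vD in rD; apply: contraNneq rD => U0.
  by case: (v_ord r) => ->; rewrite // U0 set0I.
have sum_card (A : {set V}) : \sum_i (v i \in A)%:R = #|A|%:R :> rat.
  by rewrite -sum_mem [RHS](reindex v) //; apply: onW_bij.
have Dgt0 : #|D|%:R != 0 :> rat by rewrite pnatr_eq0 cards_eq0.
have Ugt0 : #|U|%:R != 0 :> rat by rewrite pnatr_eq0 cards_eq0.
apply: (canRL (mulfK (mulf_neq0 Dgt0 Ugt0))); rewrite mulrC -(matrix_tree _ _ _ v r) //.
rewrite -[#|D|%:R]sum_card -[#|U|%:R]sum_card -det_add_rank1; first last.
- move=> j; rewrite -[RHS](laplacian_row_sum _ e _ v j) //.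
  by apply: eq_bigr => i _; apply: laplacian_sym.
- by move=> i; apply: laplacian_row_sum.
(* [det_trig] expects a lower triangular matrix, hence the transpose. *)
rewrite -det_tr det_trig; last first.
  apply/is_trig_mxP => i j ij; rewrite !mxE eD //.
  by rewrite -val_eqE gtn_eqF // mul0r add0r -natrM mulnb addNr.
(* Both products are extended by 1 to all vertices and merged, to be compared with the diagonal
   factor by factor. *)
rewrite [X in _ = X * _]big_mkcond [X in _ = _ * X]big_mkcond -big_split.
rewrite [RHS](reindex v) /=; last exact: onW_bij.
apply: eq_bigr => i _; rewrite !mxE eqxx e_irr mul1r subr0 -natrM mulnb !inE.
by case: (_ && _); rewrite /= ?mulr1 ?natr1 // mul1r addr0.
Qed.
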